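(* Let $\alpha\ge0$ and $f\in\Sigma$. Then $f\in ME(\alpha)$ if and only if $$\operatorname{Re}\left[z\left(f(z)*\frac{1+z(\alpha e^{i\gamma}-1)}{z(1-z)^2}\right)\right]>0\qquad\text{for all }\gamma\in(-\pi,\pi]\text{ and all } z\in E.$$
   Context: Let $E=\{z\in\mathbb{C}: 0<|z|<1\}$. Let $\Sigma$ be the family of functions $f(z)=z^{-1}+\sum_{n=0}^{\infty}a_nz^n$ ($a_n\in\mathbb{C}$) that are analytic in $E$, with a simple pole at $z=0$. For $0\le\alpha$, $ME(\alpha)$ is the set of $f\in\Sigma$ such that $\operatorname{Re}(zf(z))>\alpha\,|z^2f'(z)+zf(z)|$ for all $z\in E$. For $f(z)=z^{-1}+\sum_{n=0}^\infty a_nz^n$ and $g(z)=z^{-1}+\sum_{n=0}^\infty b_nz^n$ in $\Sigma$, the Hadamard product (convolution) is $(f*g)(z)=z^{-1}+\sum_{n=0}^\infty a_nb_nz^n$. *)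

(* Defs.v *)
From Stdlib Require Import Reals ClassicalEpsilon.
From Coquelicot Require Import Coquelicot.

Local Open Scope C_scope.

Definition punctured_disc (z : C) : Prop := (0 < Cmod z < 1)%R.

(* Functions on the punctured disc are total functions C -> C; their values
   elsewhere never matter. *)
Definition analytic_on_punctured_disc (f : C -> C) : Prop :=
  forall z : C, punctured_disc z ->
    @ex_derive C_AbsRing C_NormedModule f z.

(* f(z) = z^-1 + sum_(n >= 0) a_n z^n on the punctured disc. *)
Definition has_laurent_coefs (f : C -> C) (a : nat -> C) : Prop :=
  forall z : C, punctured_disc z ->
    @is_pseries C_AbsRing C_NormedModule a z (f z - / z).

(* The residue 1 in the expansion makes the pole at 0 simple. *)
Definition Sigma (f : C -> C) : Prop :=
  analytic_on_punctured_disc f /\ exists a : nat -> C, has_laurent_coefs f a.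

Definition ME (alpha : R) (f : C -> C) : Prop :=
  Sigma f /\
  forall z : C, punctured_disc z ->
    (Re (z * f z) > alpha * Cmod (z ^ 2 * C_derive f z + z * f z))%R.

(* The coefficients a_n of f in Sigma (they are unique); unspecified when f is
   not in Sigma. *)
Definition laurent_coef (f : C -> C) : nat -> C :=
  epsilon (inhabits (fun _ : nat => RtoC 0)) (has_laurent_coefs f).

(* Sum of a complex power series; unspecified where it diverges. *)
Definition CPSeries (a : nat -> C) (z : C) : C :=
  @iota C_CompleteNormedModule
    (fun l : C => @is_pseries C_AbsRing C_NormedModule a z l).

Definition hadamard (f g : C -> C) (z : C) : C :=
  / z + CPSeries (fun n => laurent_coef f n * laurent_coef g n) z.

(* e^(i t) *)
Definition expi (t : R) : C := (cos t, sin t).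

(* Main.v *)
(* The kernel has coefficients 1 + (n+1) alpha e^(i gamma), and
   sum (n+1) a_n z^(n+1) is z (z f)' = z^2 f' + z f, so z times the convolution
   is z f + alpha e^(i gamma) (z^2 f' + z f).  Its real part is positive for
   every gamma iff it is for the gamma that rotates z^2 f' + z f onto the
   negative real axis, which is the inequality defining ME.  Termwise
   differentiation and uniqueness of coefficients reduce to real power series
   by restricting to the ray through z, resp. the real axis. *)
Require Import Defs.
From Stdlib Require Import Reals ClassicalEpsilon Lra.
From Coquelicot Require Import Coquelicot.

Local Notation is_Cseries := (@is_series C_AbsRing C_NormedModule).

(** * Complex series through their real and imaginary parts *)

Lemma sum_n_Re_Im (u : nat -> C) (n : nat) :
  sum_n u n = (sum_n (fun k => Re (u k)) n, sum_n (fun k => Im (u k)) n) :> C.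
Proof.
  induction n as [|n IH].
  - rewrite !sum_O. now destruct (u 0%nat).
  - rewrite !sum_Sn, IH. reflexivity.
Qed.

Lemma is_Cseries_Re_Im (u : nat -> C) (l : C) :
  is_Cseries u l <->
  is_series (fun n => Re (u n)) (Re l) /\ is_series (fun n => Im (u n)) (Im l).
Proof.
  unfold is_series. split.
  - intros H. split; apply filterlim_locally; intros eps;
      generalize (proj1 (filterlim_locally _ _) H eps); apply filter_imp;
      intros n; rewrite sum_n_Re_Im; intros [H1 H2]; assumption.
  - intros [H1 H2]. apply filterlim_locally. intros eps.
    generalize (filter_and _ _ (proj1 (filterlim_locally _ _) H1 eps)
                  (proj1 (filterlim_locally _ _) H2 eps)).
    apply filter_imp. intros n [h1 h2]. rewrite sum_n_Re_Im. split; assumption.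
Qed.

(** Convergence in [C] is stated with the balls of a product space; a ball for [Cmod] lies inside
    the product ball of the same radius. *)
Lemma is_Cseries_Cmod (u : nat -> C) (l : C) :
  is_lim_seq (fun n => Cmod (sum_n u n - l)) 0 -> is_Cseries u l.
Proof.
  intros H. apply filterlim_locally. intros eps.
  generalize (proj2 (is_lim_seq_spec _ _) H eps). apply filter_imp.
  intros n Hn. apply C_NormedModule_mixin_compat1.
  rewrite Rminus_0_r, Rabs_pos_eq in Hn by apply Cmod_ge_0. exact Hn.
Qed.

Lemma is_Cseries_unique (u : nat -> C) (l m : C) :
  is_Cseries u l -> is_Cseries u m -> l = m.
Proof.
  rewrite !is_Cseries_Re_Im. intros [H1 H2] [H3 H4].
  apply injective_projections.
  - change (Re l = Re m). rewrite <- (is_series_unique _ _ H1). exact (is_series_unique _ _ H3).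
  - change (Im l = Im m). rewrite <- (is_series_unique _ _ H2). exact (is_series_unique _ _ H4).
Qed.

Lemma CPSeries_unique (a : nat -> C) (z l : C) :
  is_Cseries (fun n => z ^ n * a n)%C l -> CPSeries a z = l.
Proof.
  intros H. apply (@iota_unique C_AbsRing C_CompleteNormedModule).
  - intros y Hy. exact (is_Cseries_unique _ _ _ Hy H).
  - exact H.
Qed.

(** * Real power series: radius and uniqueness of coefficients *)

(** Strictly outside the disc of convergence the terms do not tend to 0, whereas those of a
    convergent series do. *)
Lemma CV_radius_ge (a : nat -> R) (x : R) :
  ex_pseries a x -> Rbar_le (Rabs x) (CV_radius a).
Proof.
  intros H. apply Rbar_not_lt_le. intros Hlt.
  apply (CV_disk_outside _ _ Hlt). apply ex_series_lim_0.
  revert H. apply ex_series_ext. intros n. rewrite pow_n_pow.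
  apply Rmult_comm.
Qed.

Lemma is_pseries_coef_unique (a b : nat -> R) (h : R -> R) (r : R) :
  (0 < r)%R ->
  (forall t, (0 < Rabs t < r)%R -> is_pseries a t (h t)) ->
  (forall t, (0 < Rabs t < r)%R -> is_pseries b t (h t)) ->
  forall n, a n = b n.
Proof.
  intros Hr Ha Hb n.
  assert (Hp : (0 < Rabs (r / 2) < r)%R) by (rewrite Rabs_pos_eq; lra).
  assert (Hrad : forall c, (forall t, (0 < Rabs t < r)%R -> is_pseries c t (h t)) ->
            Rbar_lt 0 (CV_radius (PS_incr_1 c))).
  { intros c Hc. rewrite CV_radius_incr_1.
    apply Rbar_lt_le_trans with (Rabs (r / 2)); [exact (proj1 Hp)|].
    apply CV_radius_ge. exists (h (r / 2)%R). now apply Hc. }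
  (* The value at 0 is not prescribed; multiplying by t makes it irrelevant. *)
  change (PS_incr_1 a (S n) = PS_incr_1 b (S n)).
  apply PSeries_ext_recip; [now apply Hrad | now apply Hrad |].
  exists (mkposreal r Hr). intros t Ht.
  change (Rabs (t - 0) < r)%R in Ht. rewrite Rminus_0_r in Ht.
  rewrite !PSeries_incr_1.
  destruct (Req_dec t 0) as [->|Ht0]; [ring|].
  assert (H : (0 < Rabs t < r)%R) by (split; [now apply Rabs_pos_lt | exact Ht]).
  now rewrite (is_pseries_unique _ _ _ (Ha t H)), (is_pseries_unique _ _ _ (Hb t H)).
Qed.

(** * Termwise differentiation, first real, then complex along rays *)

(** Multiplication by [t] shifts the coefficients, so differentiating [t * h t] turns [c n] into
    [(n+1) * c n]. Evaluating at [t = 1] removes the powers of [t]. *)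
Lemma is_pseries_derive_incr (c : nat -> R) (h : R -> R) (r d : R) :
  (1 < r)%R ->
  (forall t, (0 < t < r)%R -> is_pseries c t (h t)) ->
  is_derive (fun t => t * h t)%R 1%R d ->
  is_series (fun n => INR (S n) * c n)%R d.
Proof.
  intros Hr Hc Hd.
  assert (Hrad : Rbar_lt (Rabs 1) (CV_radius (PS_incr_1 c))).
  { rewrite CV_radius_incr_1.
    (* The midpoint of 1 and [r] is a point of convergence beyond 1, so 1 is strictly inside the
       radius. *)
    apply Rbar_lt_le_trans with (Rabs ((1 + r) / 2)).
    - rewrite !Rabs_pos_eq by lra. simpl. lra.
    - apply CV_radius_ge. eexists. apply Hc. lra. }
  assert (Hd' : is_derive (PSeries (PS_incr_1 c)) 1%R d).
  { revert Hd. apply is_derive_ext_loc.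
    (* This radius around 1 keeps [t] within [(0, r)]. *)
    assert (He : (0 < Rmin 1 (r - 1))%R) by (apply Rmin_pos; lra).
    exists (mkposreal _ He). intros t Ht.
    change (Rabs (t - 1) < Rmin 1 (r - 1))%R in Ht.
    apply Rmin_Rgt_l in Ht. destruct Ht as [H1 H2].
    apply Rgt_lt, Rabs_def2 in H1. apply Rgt_lt, Rabs_def2 in H2.
    rewrite PSeries_incr_1. f_equal. symmetry. apply is_pseries_unique.
    apply Hc. lra. }
  rewrite <- (is_derive_unique _ _ _ Hd').
  generalize (is_pseries_derive _ _ Hrad). apply is_series_ext.
  intros n. rewrite pow_n_pow, pow1. unfold PS_derive, PS_incr_1.
  apply Rmult_1_l.
Qed.

(* The two structures carry different balls, but differentiability only uses
   the norm of the codomain, which is Cmod in both. *)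
Lemma is_Cderive_AbsRing (f : C -> C) (z l : C) :
  @is_derive C_AbsRing C_NormedModule f z l <->
  @is_derive C_AbsRing (AbsRing_NormedModule C_AbsRing) f z l.
Proof.
  split; intros [[h1 h2 h3] h];
    (split; [split; [exact h1 | exact h2 | exact h3] | exact h]).
Qed.

(* Along the ray [t => t z] the chain rule needs only the definition of
   complex differentiability. *)
Lemma is_Cderive_ray (G : C -> C) (z l : C) :
  @is_derive C_AbsRing C_NormedModule G z l ->
  is_derive (fun t : R => Re (G (t * z)%C)) 1%R (Re (z * l)%C) /\
  is_derive (fun t : R => Im (G (t * z)%C)) 1%R (Im (z * l)%C).
Proof.
  intros [_ H].
  specialize (H z (fun P HP => HP)).
  assert (Hdom : forall eps : posreal, locally 1%R (fun t : R =>
     (Cmod (G (t * z)%C - G z - (t - 1)%R * (z * l)) <= eps * Rabs (t - 1))%R)).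
  { intros eps.
    (* Dividing the tolerances by [Cmod z + 1] instead of [Cmod z] also covers [z = 0]. *)
    assert (Hm : (0 < Cmod z + 1)%R) by (generalize (Cmod_ge_0 z); lra).
    destruct (H (mkposreal _ (Rdiv_lt_0_compat _ _ (cond_pos eps) Hm))) as [del Hdel].
    exists (mkposreal _ (Rdiv_lt_0_compat _ _ (cond_pos del) Hm)).
    intros t Ht. change (Rabs (t - 1) < del / (Cmod z + 1))%R in Ht.
    assert (Htz : Cmod (t * z - z)%C = (Rabs (t - 1) * Cmod z)%R).
    { replace (t * z - z)%C with ((t - 1)%R * z)%C
        by (rewrite RtoC_minus; ring).
      now rewrite Cmod_mult, Cmod_R. }
    assert (Hlt : (Cmod (t * z - z)%C < del)%R).
    { rewrite Htz. apply Rle_lt_trans with (Rabs (t - 1) * (Cmod z + 1))%R.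
      - apply Rmult_le_compat_l; [apply Rabs_pos | lra].
      - apply Rmult_lt_reg_r with (/ (Cmod z + 1))%R.
        + now apply Rinv_0_lt_compat.
        + rewrite Rmult_assoc, Rinv_r, Rmult_1_r by lra. exact Ht. }
    specialize (Hdel (t * z)%C Hlt).
    change (Cmod (G (t * z)%C - G z - (t * z - z) * l)%C
             <= eps / (Cmod z + 1) * Cmod (t * z - z)%C)%R in Hdel.
    replace ((t - 1)%R * (z * l))%C with ((t * z - z) * l)%C
      by (rewrite RtoC_minus; ring).
    apply Rle_trans with (1 := Hdel). rewrite Htz.
    replace (eps / (Cmod z + 1) * (Rabs (t - 1) * Cmod z))%R
      with (eps * Rabs (t - 1) * (Cmod z / (Cmod z + 1)))%R by (field; lra).
    rewrite <- (Rmult_1_r (eps * Rabs (t - 1))) at 2.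
    apply Rmult_le_compat_l.
    - apply Rmult_le_pos; [apply Rlt_le, cond_pos | apply Rabs_pos].
    - apply Rmult_le_reg_r with (Cmod z + 1)%R; [exact Hm|].
      unfold Rdiv. rewrite Rmult_assoc, Rinv_l by lra. lra. }
  split; (split; [apply is_linear_scal_l|]); intros x Hx;
    rewrite <- (is_filter_lim_locally_unique _ _ Hx); intros eps;
    generalize (Hdom eps); apply filter_imp; intros t Ht;
    refine (Rle_trans _ _ _ _ Ht).
  - refine (Rle_trans _ _ _ _ (Rle_trans _ _ _ (Rmax_l _ (Rabs (Im _))) (Rmax_Cmod _))).
    apply Req_le.
    change (Rabs (Re (G (t * z)%C) - Re (G (1 * z)%C) - (t - 1) * Re (z * l)%C)
      = Rabs (Re (G (t * z)%C - G z - (t - 1)%R * (z * l))%C))%R.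
    f_equal. rewrite Cmult_1_l. unfold Re, Im. simpl. ring.
  - refine (Rle_trans _ _ _ _ (Rle_trans _ _ _ (Rmax_r (Rabs (Re _)) _) (Rmax_Cmod _))).
    apply Req_le.
    change (Rabs (Im (G (t * z)%C) - Im (G (1 * z)%C) - (t - 1) * Im (z * l)%C)
      = Rabs (Im (G (t * z)%C - G z - (t - 1)%R * (z * l))%C))%R.
    f_equal. rewrite Cmult_1_l. unfold Re, Im. simpl. ring.
Qed.

(** The sum is the derivative of [w * f w] at [z]. On the ray through [z] this becomes a real
    derivative at [t = 1], where the series can be differentiated termwise; a factor [z] from the
    chain rule is divided out at the end. *)
Lemma laurent_euler_series (f : C -> C) (a : nat -> C) (z l : C) :
  has_laurent_coefs f a -> punctured_disc z ->
  @is_derive C_AbsRing C_NormedModule f z l ->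
  is_Cseries (fun n => z ^ n * (INR (S n) * a n))%C (f z + z * l)%C.
Proof.
  intros Ha Hz Hl.
  assert (Hz0 : z <> 0%C) by (apply Cmod_gt_0, Hz).
  (* The ray point [t * z] stays in the punctured disc for [0 < t < / Cmod z], an interval with 1 in
     its interior. *)
  assert (Hr : (1 < / Cmod z)%R).
  { rewrite <- Rinv_1 at 1. apply Rinv_lt_contravar; [|apply Hz].
    rewrite Rmult_1_r. apply Hz. }
  (* The factor [z] is chosen so that [t * h t = t * z * f (t * z) - 1], where the pole has become a
     constant. *)
  set (h := fun t : R => (z * (f (t * z) - / (t * z)))%C).
  assert (Hh : forall t : R, (0 < t < / Cmod z)%R ->
    is_pseries (fun n => Re (z * (z ^ n * a n))%C) t (Re (h t)) /\
    is_pseries (fun n => Im (z * (z ^ n * a n))%C) t (Im (h t))).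
  { intros t Ht.
    assert (Htz : punctured_disc (t * z)%C).
    { unfold punctured_disc. rewrite Cmod_mult, Cmod_R, Rabs_pos_eq by lra.
      split; [apply Rmult_lt_0_compat; [apply Ht | apply Hz]|].
      apply Rmult_lt_reg_r with (/ Cmod z)%R; [lra|].
      rewrite Rmult_assoc, Rinv_r, Rmult_1_r, Rmult_1_l; [apply Ht|].
      apply Rgt_not_eq, Hz. }
    generalize (is_series_scal z _ _ (Ha _ Htz)). intros Hs.
    change (is_Cseries (fun n => z * ((t * z) ^ n * a n))%C (h t)) in Hs.
    apply is_Cseries_Re_Im in Hs. destruct Hs as [Hs1 Hs2].
    split; [revert Hs1 | revert Hs2]; apply is_series_ext; intros n;
      rewrite pow_n_pow, Cpow_mult_l, <- RtoC_pow;
      replace (z * ((t ^ n)%R * z ^ n * a n))%C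
        with ((t ^ n)%R * (z * (z ^ n * a n)))%C by ring;
      generalize (z * (z ^ n * a n))%C; intros c;
      unfold Re, Im; simpl; change scal with Rmult; ring. }
  assert (HG : @is_derive C_AbsRing C_NormedModule
                 (fun w => w * f w)%C z (f z + z * l)%C).
  { apply is_Cderive_AbsRing in Hl. apply is_Cderive_AbsRing.
    generalize (@is_derive_mult C_AbsRing (fun w => w) f z (RtoC 1) l
       (is_derive_id (K := C_AbsRing) z) Hl Cmult_comm).
    change (plus (mult (RtoC 1) (f z)) (mult z l)) with (1 * f z + z * l)%C.
    now rewrite Cmult_1_l. }
  apply is_Cderive_ray in HG. destruct HG as [HG1 HG2].
  assert (Hloc : locally 1%R (fun t : R => (t * z * f (t * z) - 1)%C = (t * h t)%C)).
  { exists (mkposreal 1 Rlt_0_1). intros t Ht.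
    change (Rabs (t - 1) < 1)%R in Ht. apply Rabs_def2 in Ht.
    unfold h. field. split; [exact Hz0|].
    intros E. apply RtoC_inj in E. lra. }
  assert (D1 : is_derive (fun t => t * Re (h t))%R 1%R (Re (z * (f z + z * l))%C)).
  { apply is_derive_ext_loc with (fun t : R => Re (t * z * f (t * z))%C - 1)%R.
    - revert Hloc. apply filter_imp. intros t E.
      transitivity (Re (t * h t)%C); [rewrite <- E|]; unfold Re; simpl; ring.
    - rewrite <- (Rminus_0_r (Re (z * (f z + z * l))%C)).
      exact (is_derive_minus _ _ _ _ _ HG1 (is_derive_const 1%R 1%R)). }
  assert (D2 : is_derive (fun t => t * Im (h t))%R 1%R (Im (z * (f z + z * l))%C)).
  (* The subtracted constant 1 is real, so nothing has to be removed from the imaginary part. *)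
  { apply is_derive_ext_loc with (fun t : R => Im (t * z * f (t * z))%C).
    - revert Hloc. apply filter_imp. intros t E.
      transitivity (Im (t * h t)%C); [rewrite <- E|]; unfold Im; simpl; ring.
    - exact HG2. }
  apply (is_pseries_derive_incr _ _ _ _ Hr (fun t Ht => proj1 (Hh t Ht))) in D1.
  apply (is_pseries_derive_incr _ _ _ _ Hr (fun t Ht => proj2 (Hh t Ht))) in D2.
  assert (Hs : is_Cseries (fun n => INR (S n) * (z * (z ^ n * a n)))%C
                 (z * (f z + z * l))%C).
  { apply is_Cseries_Re_Im. split; [revert D1 | revert D2]; apply is_series_ext;
      intros n; generalize (z * (z ^ n * a n))%C; generalize (INR (S n));
      intros r c; unfold Re, Im; simpl; ring. }
  apply (is_series_scal (/ z)%C) in Hs.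
  replace (f z + z * l)%C with (/ z * (z * (f z + z * l)))%C by now field.
  revert Hs. apply is_series_ext. intros n.
  change (/ z * (INR (S n) * (z * (z ^ n * a n))) = z ^ n * (INR (S n) * a n))%C.
  now field.
Qed.

(** * Expansion of the kernel *)

(** These are the terms of the differentiated geometric series, which converges inside radius 1. *)
Lemma is_lim_seq_INR_geom (r : R) :
  (0 <= r < 1)%R -> is_lim_seq (fun n => INR (S n) * r ^ n)%R 0%R.
Proof.
  intros Hr.
  assert (Hrad : CV_radius (fun _ => 1%R) = Finite (/ 1)%R).
  { apply CV_radius_finite_DAlembert; [intros; lra | lra |].
    apply is_lim_seq_ext with (fun _ => 1%R); [|apply is_lim_seq_const].
    intros n. rewrite Rdiv_1_r, Rabs_R1. reflexivity. }
  assert (Hs : ex_pseries (PS_derive (fun _ => 1%R)) r).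
  { apply ex_pseries_derive. rewrite Hrad, Rinv_1, Rabs_pos_eq by lra.
    apply Hr. }
  apply ex_series_lim_0. revert Hs. apply ex_series_ext. intros n.
  rewrite pow_n_pow. unfold PS_derive. change scal with Rmult. simpl; ring.
Qed.

(** An exact remainder for the geometric series plus [q] times its derived series; the factor
    [w ^ S n] supplies the decay when [Cmod w < 1]. *)
Lemma kernel_partial_sum (w q : C) (n : nat) :
  (1 - w <> 0)%C ->
  (sum_n (fun k => w ^ k * (1 + INR (S k) * q))%C n
   - (1 / (1 - w) + q / (1 - w) ^ 2)
   = - (w ^ S n * (1 / (1 - w) + q * (1 + INR (S n) * (1 - w)) / (1 - w) ^ 2)))%C.
Proof.
  intros H. induction n as [|n IH].
  - rewrite sum_O. simpl. now field.
  - rewrite sum_Sn. change plus with Cplus.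
    rewrite (S_INR (S n)), RtoC_plus.
    match goal with |- (?s + ?t - ?L)%C = _ =>
      replace (s + t - L)%C with ((s - L) + t)%C by ring end.
    rewrite IH. rewrite !Cpow_S. now field.
Qed.

Lemma kernel_laurent_coefs (q : C) :
  has_laurent_coefs (fun w => (1 + w * (q - 1)) / (w * (1 - w) ^ 2))%C
    (fun n => 1 + INR (S n) * q)%C.
Proof.
  intros w Hw.
  assert (Hw0 : w <> 0%C) by (apply Cmod_gt_0, Hw).
  assert (Hw1 : (1 - w <> 0)%C).
  { intros E. assert (w = 1%C) as -> by (rewrite <- (Cplus_0_r w), <- E; ring).
    destruct Hw as [_ Hw]. rewrite Cmod_1 in Hw. lra. }
  change (is_Cseries (fun n => w ^ n * (1 + INR (S n) * q))%C
     ((1 + w * (q - 1)) / (w * (1 - w) ^ 2) - / w)%C).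
  replace ((1 + w * (q - 1)) / (w * (1 - w) ^ 2) - / w)%C
    with (1 / (1 - w) + q / (1 - w) ^ 2)%C by (field; tauto).
  apply is_Cseries_Cmod.
  (* Moduli of the three pieces of the remainder; only the piece measured by [D] carries a factor
     growing with [n], and that growth is linear. *)
  set (A := Cmod (1 / (1 - w))). set (B := Cmod (q / (1 - w) ^ 2)).
  set (D := Cmod (q / (1 - w))).
  apply is_lim_seq_le_le with (fun _ => 0%R)
    (fun n => (A + B + D) * (INR (S (S n)) * Cmod w ^ S n))%R.
  - intros n. split; [apply Cmod_ge_0|].
    rewrite kernel_partial_sum, Cmod_opp, Cmod_mult, Cmod_pow by exact Hw1.
    assert (Hle : (Cmod (1 / (1 - w) + q * (1 + INR (S n) * (1 - w)) / (1 - w) ^ 2)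
                   <= (A + B + D) * INR (S (S n)))%R).
    { replace (1 / (1 - w) + q * (1 + INR (S n) * (1 - w)) / (1 - w) ^ 2)%C
        with (1 / (1 - w) + q / (1 - w) ^ 2 + INR (S n) * (q / (1 - w)))%C
        by now field.
      apply Rle_trans with (A + B + INR (S n) * D)%R.
      - eapply Rle_trans; [apply Cmod_triangle|].
        apply Rplus_le_compat; [apply Cmod_triangle|].
        rewrite Cmod_mult, Cmod_R, Rabs_pos_eq by apply pos_INR. apply Rle_refl.
      - rewrite (S_INR (S n)).
        generalize (pos_INR (S n)) (Cmod_ge_0 (1 / (1 - w)))
          (Cmod_ge_0 (q / (1 - w) ^ 2)) (Cmod_ge_0 (q / (1 - w))).
        fold A B D. intros. nra. }
    assert (Hp : (0 <= Cmod w ^ S n)%R) by apply pow_le, Cmod_ge_0.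
    nra.
  - apply is_lim_seq_const.
  - replace (Finite 0) with (Rbar_mult (A + B + D)%R 0%R)
      by (simpl; now rewrite Rmult_0_r).
    apply is_lim_seq_scal_l.
    (* The bound is the sequence [(n+1) * Cmod w ^ n] shifted by one index. *)
    apply (is_lim_seq_incr_1 (fun n => INR (S n) * Cmod w ^ n)%R).
    apply is_lim_seq_INR_geom. split; [apply Cmod_ge_0 | apply Hw].
Qed.

(** * Uniqueness of Laurent coefficients and convolution with the kernel *)

(** Since [laurent_coef] is chosen by [epsilon], uniqueness is what identifies the chosen
    coefficients of the kernel with the explicit ones. *)
Lemma laurent_coefs_unique (g : C -> C) (a b : nat -> C) (n : nat) :
  has_laurent_coefs g a -> has_laurent_coefs g b -> a n = b n.
Proof.
  intros Ha Hb.
  set (h := fun t : R => (g t - / t)%C).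
  assert (H : forall c, has_laurent_coefs g c -> forall t : R, (0 < Rabs t < 1)%R ->
     is_pseries (fun n => Re (c n)) t (Re (h t)) /\
     is_pseries (fun n => Im (c n)) t (Im (h t))).
  { intros c Hc t Ht. rewrite <- Cmod_R in Ht.
    generalize (Hc t Ht). intros Hs.
    change (is_Cseries (fun n => t ^ n * c n)%C (h t)) in Hs.
    apply is_Cseries_Re_Im in Hs. destruct Hs as [Hs1 Hs2].
    split; [revert Hs1 | revert Hs2]; apply is_series_ext; intros k;
      rewrite pow_n_pow, <- RtoC_pow; unfold Re, Im; simpl;
      change scal with Rmult; ring. }
  apply injective_projections.
  - exact (is_pseries_coef_unique _ _ _ _ Rlt_0_1
      (fun t Ht => proj1 (H a Ha t Ht)) (fun t Ht => proj1 (H b Hb t Ht)) n).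
  - exact (is_pseries_coef_unique _ _ _ _ Rlt_0_1
      (fun t Ht => proj2 (H a Ha t Ht)) (fun t Ht => proj2 (H b Hb t Ht)) n).
Qed.

Lemma laurent_coef_spec (f : C -> C) (a : nat -> C) :
  has_laurent_coefs f a -> has_laurent_coefs f (laurent_coef f).
Proof.
  intros Ha. unfold laurent_coef. apply epsilon_spec. now exists a.
Qed.

Lemma hadamard_kernel (f : C -> C) (q z : C) :
  Sigma f -> punctured_disc z ->
  (z * hadamard f (fun w => (1 + w * (q - 1)) / (w * (1 - w) ^ 2)) z
   = z * f z + q * (z ^ 2 * C_derive f z + z * f z))%C.
Proof.
  intros [Hf [a0 Ha0]] Hz.
  assert (Hz0 : z <> 0%C) by (apply Cmod_gt_0, Hz).
  assert (Ha := laurent_coef_spec f a0 Ha0).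
  set (a := laurent_coef f) in *.
  set (g := fun w => ((1 + w * (q - 1)) / (w * (1 - w) ^ 2))%C).
  assert (Hg := kernel_laurent_coefs q). fold g in Hg.
  assert (Hb := laurent_coef_spec g _ Hg).
  assert (Hl := laurent_euler_series f a z _ Ha Hz (C_derive_correct f z 0%C (Hf z Hz))).
  assert (Hs : is_Cseries (fun n => z ^ n * (a n * laurent_coef g n))%C
     ((f z - / z) + q * (f z + z * C_derive f z))%C).
  (* The coefficient [1 + (n+1) * q] splits the product series into that of [f z - / z] and [q]
     times the differentiated one. *)
  { generalize (is_series_plus _ _ _ _ (Ha z Hz) (is_series_scal q _ _ Hl)).
    apply is_series_ext. intros n.
    rewrite (laurent_coefs_unique g _ _ n Hb Hg).
    change (z ^ n * a n + q * (z ^ n * (INR (S n) * a n))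
            = z ^ n * (a n * (1 + INR (S n) * q)))%C. ring. }
  unfold hadamard. fold a. rewrite (CPSeries_unique _ _ _ Hs).
  now field.
Qed.

(** * Rotations and the equivalence *)

(** The angle is [acos x] up to sign, and the sign of [y] decides which. *)
Lemma unit_vector_angle (x y : R) :
  (x ^ 2 + y ^ 2 = 1)%R ->
  exists gamma, (- PI < gamma <= PI)%R /\ expi gamma = (x, y).
Proof.
  intros H.
  assert (Hx : (-1 <= x <= 1)%R) by (split; nra).
  assert (Hs : sqrt (1 - x²) = Rabs y).
  { rewrite <- sqrt_Rsqr_abs. f_equal. unfold Rsqr. lra. }
  generalize PI_RGT_0 (acos_bound x). intros Hpi Hb.
  destruct (Rle_lt_dec 0 y) as [Hy|Hy].
  - exists (acos x). split; [lra|]. unfold expi.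
    rewrite cos_acos, sin_acos, Hs, Rabs_pos_eq by assumption. reflexivity.
  - exists (- acos x)%R. split.
    (* The excluded endpoint [-PI] would need [x = -1], hence [y = 0], against [y < 0]. *)
    + split; [|lra]. destruct (Req_dec (acos x) PI) as [E|E]; [|lra].
      assert (x = -1)%R by (rewrite <- (cos_acos x Hx), E; apply cos_PI). nra.
    + unfold expi. rewrite cos_neg, sin_neg, cos_acos, sin_acos, Hs by assumption.
      rewrite Rabs_left by assumption. now rewrite Ropp_involutive.
Qed.

Lemma Cmod_expi (t : R) : Cmod (expi t) = 1%R.
Proof.
  unfold Cmod, expi. simpl fst. simpl snd. rewrite <- !Rsqr_pow2.
  rewrite Rplus_comm, sin2_cos2. apply sqrt_1.
Qed.

Lemma Re_expi_mult_ge (t : R) (w : C) : (- Cmod w <= Re (expi t * w)%C)%R.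
Proof.
  generalize (re_le_Cmod (expi t * w)%C). rewrite Cmod_mult, Cmod_expi, Rmult_1_l.
  intros H. apply Rabs_le_between in H. apply H.
Qed.

(** Shows that the lower bound of [Re_expi_mult_ge] is attained within the allowed range of
    angles. *)
Lemma expi_rotate_neg (w : C) :
  exists gamma, (- PI < gamma <= PI)%R /\ Re (expi gamma * w)%C = (- Cmod w)%R.
Proof.
  destruct (Ceq_dec w 0%C) as [->|Hw].
  - exists PI. generalize PI_RGT_0. intros. split; [lra|].
    rewrite Cmult_0_r, Cmod_0. simpl. ring.
  - apply Cmod_gt_0 in Hw.
    assert (Hsq : (Cmod w ^ 2 = fst w ^ 2 + snd w ^ 2)%R).
    { unfold Cmod. rewrite pow2_sqrt; [reflexivity|].
      generalize (pow2_ge_0 (fst w)) (pow2_ge_0 (snd w)). lra. }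
    (* The unit vector is minus the conjugate of [w] over [Cmod w]; its product with [w] is
       [- Cmod w]. *)
    destruct (unit_vector_angle (- fst w / Cmod w) (snd w / Cmod w)) as [g [Hg Eg]].
    + replace ((- fst w / Cmod w) ^ 2 + (snd w / Cmod w) ^ 2)%R
        with ((fst w ^ 2 + snd w ^ 2) / Cmod w ^ 2)%R by (field; lra).
      rewrite <- Hsq. field. lra.
    + exists g. split; [exact Hg|]. rewrite Eg. unfold Re. simpl.
      replace (- fst w / Cmod w * fst w - snd w / Cmod w * snd w)%R
        with (- ((fst w ^ 2 + snd w ^ 2) / Cmod w))%R by (field; lra).
      rewrite <- Hsq. field. lra.
Qed.

Theorem theorem3p1 (alpha : R) (f : C -> C)
    (Halpha : (0 <= alpha)%R) (Hf : Sigma f) :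
  ME alpha f <->
  (forall (gamma : R) (z : C),
     (- PI < gamma <= PI)%R -> punctured_disc z ->
     (Re (z * hadamard f
                (fun w : C =>
                   (1 + w * (alpha * expi gamma - 1)) / (w * (1 - w) ^ 2))
                z)%C > 0)%R).
Proof.
  assert (E : forall gamma z, punctured_disc z ->
    Re (z * hadamard f
          (fun w : C => (1 + w * (alpha * expi gamma - 1)) / (w * (1 - w) ^ 2)) z)%C
    = (Re (z * f z)%C
       + alpha * Re (expi gamma * (z ^ 2 * C_derive f z + z * f z))%C)%R).
  { intros gamma z Hz. rewrite hadamard_kernel by assumption.
    rewrite <- Cmult_assoc. generalize (expi gamma * (z ^ 2 * C_derive f z + z * f z))%C.
    intros v. unfold Re. simpl. ring. }
  split.
  - intros [_ H] gamma z _ Hz. rewrite E by exact Hz.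
    (* The sign of [alpha] lets the lower bound on the rotated term be scaled. *)
    generalize (H z Hz) (Rmult_le_compat_l _ _ _ Halpha
      (Re_expi_mult_ge gamma (z ^ 2 * C_derive f z + z * f z)%C)). lra.
  - intros H. split; [exact Hf|]. intros z Hz.
    (* The worst angle depends on [z], which is allowed because the hypothesis holds for every pair
       [gamma], [z]. *)
    destruct (expi_rotate_neg (z ^ 2 * C_derive f z + z * f z)%C) as [gamma [Hg Eg]].
    generalize (H gamma z Hg Hz). rewrite E, Eg by exact Hz. lra.
Qed.
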